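(* Let $n^\star_{\mathcal{A}}(\lambda^\star)=\min\{n\in\mathbb{N}:\varphi_{\mathcal{A}}(n)<\rho_r(\lambda^\star)/C_\Psi\}$ be the classification iteration complexity of an algorithm $\mathcal{A}$ with rate function $\varphi_{\mathcal{A}}$. Substituting standard rate functions $\varphi$ yields the following classifier-stabilization iteration counts, with constants absorbed into the $\mathcal{O}(\cdot)$ notation: (a) Linearly convergent methods (block coordinate descent under the KL property, interior-point methods in quadratic phase): $\varphi(n)=c\,q^n$ with $q\in(0,1)$, giving $n^\star=\mathcal{O}\bigl(\log(C_\Psi/\rho_r)/\log(1/q)\bigr)$. (b) ADMM at $\mathcal{O}(1/n)$ rate: $\varphi(n)=c/n$, giving $n^\star=\mathcal{O}(C_\Psi/\rho_r)$. (c) Mirror descent and SGD at $\mathcal{O}(1/\sqrt n)$ rate: $\varphi(n)=c/\sqrt n$, giving $n^\star=\mathcal{O}\bigl((C_\Psi/\rho_r)^2\bigr)$. (d) Frank--Wolfe at $\mathcal{O}(1/n)$ rate: $\varphi(n)=c/n$, giving $n^\star=\mathcal{O}(C_\Psi/\rho_r)$. (e) Newton-type interior-point methods in their quadratically convergent regime: $\varphi(n)=c\,q^{2^n}$, giving $n^\star=\mathcal{O}\bigl(\log\log(C_\Psi/\rho_r)\bigr)$.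
   Context: Setting: an algorithm $\mathcal{A}$ produces multiplier iterates $\hat\lambda^{(n)}\in\mathbb{R}^m_+$ with $\|\hat\lambda^{(n)}-\lambda^\star\|_2\le\varphi_{\mathcal{A}}(n)$, where $\varphi_{\mathcal{A}}:\mathbb{N}\to\mathbb{R}_{>0}$, $\varphi_{\mathcal{A}}(n)\downarrow0$. Here $c>0$ and $q\in(0,1)$ are constants of the method. For $\lambda\in\mathbb{R}^m_+$ let $L(\lambda)=\sum_i\lambda_i$; $\bar\lambda=\lambda/L(\lambda)$ if $L(\lambda)>0$, $\bar\lambda=0$ otherwise; $\bar\lambda_{(1)}\ge\cdots\ge\bar\lambda_{(m)}$ the sorted entries. Fix $\Theta=(\delta,\theta,\gamma,k)$ with $0<\delta<\tfrac12$, $\theta\in(\tfrac12,1)$, $\gamma\in(0,1)$, $k\in\{1,\dots,m-1\}$. $\Sigma_k(\lambda)=\sum_{j=1}^k\bar\lambda_{(j)}$, $\sigma_\delta(\lambda)=\frac1m|\{i:\bar\lambda_i>\delta\}|$, $\tau(\lambda)=\bar\lambda_{(2)}$. Core regimes in $\mathbb{R}^m_+$: $\mathcal{R}_{\mathrm{unc}}^\circ=\{L<\delta\}$; $\mathcal{R}_{\mathrm{res}}^\circ=\{L>\delta,\Sigma_k>\theta\}$; $\mathcal{R}_{\mathrm{sat}}^\circ=\{L>\delta,\Sigma_k<\theta,\sigma_\delta>\gamma\}$; $\mathcal{R}_{\mathrm{coup}}^\circ=\{L>\delta,\Sigma_k<\theta,\sigma_\delta<\gamma,\tau>\delta\}$.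 $\lambda^\star\in\mathcal{R}_r^\circ$ for a core regime $r$, and the feature margin $\rho_r=\rho_r(\lambda^\star)>0$ is the minimum of those among $|L(\lambda^\star)-\delta|$, $|\Sigma_k(\lambda^\star)-\theta|$, $|\sigma_\delta(\lambda^\star)-\gamma|$, $|\tau(\lambda^\star)-\delta|$ whose corresponding inequality appears in the definition of $\mathcal{R}_r^\circ$. $C_\Psi$ is the (finite) joint Lipschitz constant of $\lambda\mapsto(L,\Sigma_k,\sigma_\delta,\tau)$ on a bounded neighborhood of $\lambda^\star$ (from $\|\cdot\|_2$ to $\|\cdot\|_\infty$). *)

(* Defs.v *)
From HB Require Import structures.
From mathcomp Require Import all_boot all_order all_algebra.
From mathcomp Require Import all_classical all_reals all_analysis.

Set Implicit Arguments.
Unset Strict Implicit.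
Unset Printing Implicit Defensive.

Import Order.TTheory GRing.Theory Num.Theory.
Import numFieldNormedType.Exports.

Local Open Scope classical_set_scope.
Local Open Scope ring_scope.

(* The library norm on 'rV[R]_m is the sup norm, hence this definition. *)
Definition norm2 (R : realType) (m : nat) (x : 'rV[R]_m) : R :=
  Num.sqrt (\sum_(i < m) x ord0 i ^+ 2).

Definition orthant (R : realType) (m : nat) : set 'rV[R]_m :=
  [set x | forall i, 0 <= x ord0 i].
Arguments orthant : clear implicits.

Record hyperparams (R : realType) (m : nat) := Hyperparams {
  delta : R;
  theta : R;
  gamma : R;
  kk : nat;
  delta_bounds : 0 < delta < 2^-1;
  theta_bounds : 2^-1 < theta < 1;
  gamma_bounds : 0 < gamma < 1;
  kk_bounds : (0 < kk < m)%N
}.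

Section Features.
Variables (R : realType) (m : nat) (Theta : hyperparams R m).
Implicit Types l : 'rV[R]_m.

Definition load l : R := \sum_(i < m) l ord0 i.

Definition lbar l : 'rV[R]_m := if 0 < load l then (load l)^-1 *: l else 0.

(* [lbar_sorted l j] is the (j+1)-st largest entry: positions start at 0. *)
Definition lbar_sorted l (j : nat) : R :=
  nth 0 (sort (fun x y : R => y <= x) [seq lbar l ord0 i | i <- enum 'I_m]) j.

Definition Sigma_k l : R := \sum_(j < kk Theta) lbar_sorted l j.

Definition sigma_delta l : R :=
  #|[set i : 'I_m | delta Theta < lbar l ord0 i]%SET|%:R / m%:R.

Definition tau l : R := lbar_sorted l 1.

(* The norm of the product type is the max norm. *)
Definition features l : R * R * R * R :=
  (load l, Sigma_k l, sigma_delta l, tau l).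

End Features.

Inductive regime := unc | res | sat | coup.

Definition core_regime (R : realType) (m : nat) (Theta : hyperparams R m)
    (r : regime) : set 'rV[R]_m :=
  orthant R m `&`
  match r with
  | unc => [set l | load l < delta Theta]
  | res => [set l | delta Theta < load l /\ theta Theta < Sigma_k Theta l]
  | sat => [set l | [/\ delta Theta < load l, Sigma_k Theta l < theta Theta
                      & gamma Theta < sigma_delta Theta l]]
  | coup => [set l | [/\ delta Theta < load l, Sigma_k Theta l < theta Theta,
                         sigma_delta Theta l < gamma Theta
                       & delta Theta < tau l]]
  end.

Definition margin (R : realType) (m : nat) (Theta : hyperparams R m)
    (r : regime) (l : 'rV[R]_m) : R :=
  let dL := `|load l - delta Theta| in
  let dS := `|Sigma_k Theta l - theta Theta| in
  let ds := `|sigma_delta Theta l - gamma Theta| in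
  let dt := `|tau l - delta Theta| in
  match r with
  | unc => dL
  | res => Num.min dL dS
  | sat => Num.min dL (Num.min dS ds)
  | coup => Num.min dL (Num.min dS (Num.min ds dt))
  end.

Definition lipschitz_constants (R : realType) (m : nat)
    (Theta : hyperparams R m) (U : set 'rV[R]_m) : set R :=
  [set C | 0 <= C /\
    forall x y, (U `&` orthant R m) x -> (U `&` orthant R m) y ->
      `|features Theta x - features Theta y| <= C * norm2 (x - y)].

(* [finite_C] is a genuine restriction: it fails where sigma_delta jumps, and at
   lstar = 0, where lbar is discontinuous. *)
Record problem (R : realType) := Problem {
  dim : nat;
  Theta : hyperparams R dim;
  reg : regime;
  lstar : 'rV[R]_dim;
  nbd : set 'rV[R]_dim;
  lstar_core : core_regime Theta reg lstar;
  nbd_lstar : nbhs lstar nbd;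
  nbd_bounded : bounded_set nbd;
  finite_C : lipschitz_constants Theta nbd !=set0
}.
Arguments nbd {R} p _.

Definition rho (R : realType) (P : problem R) : R :=
  margin (Theta P) (reg P) (lstar P).

(* The least Lipschitz constant, from norm2 to the max norm, of the features on
   the part of the neighborhood that lies in the orthant. *)
Definition C_Psi (R : realType) (P : problem R) : R :=
  inf (lipschitz_constants (Theta P) (nbd P)).

(* Iterations are numbered from 1, so that the rates c / n and c / sqrt n are
   positive; the values at index 0 are irrelevant. *)
Record algorithm (R : realType) (P : problem R) := Algorithm {
  lhat : nat -> 'rV[R]_(dim P);
  rate : nat -> R;
  lhat_orthant : forall n, (0 < n)%N -> orthant R (dim P) (lhat n);
  lhat_rate : forall n, (0 < n)%N -> norm2 (lhat n - lstar P) <= rate n;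
  rate_gt0 : forall n, (0 < n)%N -> 0 < rate n;
  rate_decr : forall n p, (0 < n)%N -> (n <= p)%N -> rate p <= rate n;
  rate_cvg0 : rate @ \oo --> (0 : R)
}.

Record run (R : realType) := Run {
  prob : problem R;
  alg : algorithm prob
}.

Definition C_over_rho (R : realType) (X : run R) : R := C_Psi (prob X) / rho (prob X).

Section WellDefined.
Variable R : realType.

Lemma rho_gt0 (P : problem R) : 0 < rho P.
Proof.
case: P => m Th r l U [/= l0 lr] nU bU fC; rewrite /rho /margin /=.
have pd (a b : R) : a < b -> 0 < `|a - b|.
  by move=> ab; rewrite normr_gt0 subr_eq0 lt_eqF.
have pd' (a b : R) : b < a -> 0 < `|a - b| by rewrite distrC; exact: pd.
case: r lr => /=.
- exact: pd.
- by case=> ? ?; rewrite lt_min !pd'.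
- by case=> a b d; rewrite !lt_min (pd' _ _ a) (pd _ _ b) (pd' _ _ d).
- by case=> a b d e; rewrite !lt_min (pd' _ _ a) (pd _ _ b) (pd _ _ d) (pd' _ _ e).
Qed.

(* Perturbing the first coordinate moves the load at unit rate. *)
Lemma C_Psi_gt0 (P : problem R) : 0 < C_Psi P.
Proof.
case: P => m Th r l U [/= l0 lr] nU bU fC; rewrite /C_Psi /=.
apply: lt_le_trans ltr01 _; apply: lb_le_inf => // C [C0 CL].
have /andP[k0 km] := kk_bounds Th.
pose i0 : 'I_m := Ordinal (leq_ltn_trans (leq0n _) km).
have /nbhs_ballP[e /= e0 eU] := nU.
pose t := e / 2; have t0 : 0 < t by rewrite divr_gt0.
pose v : 'rV[R]_m := l + t *: delta_mx ord0 i0.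
have vE i : v ord0 i = l ord0 i + t * (i == i0)%:R by rewrite !mxE eqxx.
have Uv : U v.
  apply: eU; split=> // i j.
  rewrite -ball_normE /= (ord1 i) vE opprD addrA subrr.
  rewrite sub0r normrN normrM (gtr0_norm t0) ger0_norm ?ler0n //.
  apply: (@le_lt_trans _ _ t); last by rewrite /t gtr_pMr // invf_lt1 ?ltr1n.
  by case: (j == i0); rewrite ?mulr1 ?mulr0 ?(ltW t0).
have Ul : U l by apply: nbhs_singleton.
have v0 : orthant R m v.
  by move=> i; rewrite vE; apply: addr_ge0 (l0 i) _; rewrite mulr_ge0 ?(ltW t0).
have := CL v l (conj Uv v0) (conj Ul l0).
have -> : norm2 (v - l) = t.
  rewrite /norm2 (bigD1 i0) //= big1 => [|i ii0].
    by rewrite !mxE !eqxx mulr1 addrAC subrr add0r addr0 sqrtr_sqr gtr0_norm.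
  by rewrite !mxE (negPf ii0) andbF mulr0 addr0 subrr expr0n.
have -> : features Th v - features Th l =
   (load v - load l, Sigma_k Th v - Sigma_k Th l,
    sigma_delta Th v - sigma_delta Th l, tau v - tau l) by [].
have -> : load v - load l = t.
  rewrite /load -sumrB (bigD1 i0) //= big1 => [|i ii0].
    by rewrite vE eqxx mulr1 addr0 addrAC subrr add0r.
  by rewrite vE (negPf ii0) mulr0 addr0 subrr.
rewrite prod_normE /= prod_normE /= prod_normE /= !ge_max (gtr0_norm t0).
by case/andP => /andP[/andP[+ _] _] _; rewrite -{1}[t]mul1r ler_pM2r.
Qed.

Lemma n_star_subproof (X : run R) : exists n,
  (0 < n)%N && (rate (alg X) n < rho (prob X) / C_Psi (prob X)).
Proof.
have e0 : 0 < rho (prob X) / C_Psi (prob X).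
  by rewrite divr_gt0 ?rho_gt0 ?C_Psi_gt0.
have /cvgrPdist_lt/(_ _ e0)[N _ NP] := @rate_cvg0 _ _ (alg X).
exists N.+1 => /=; have := NP N.+1 (leqnSn N).
by rewrite /= sub0r normrN; apply: le_lt_trans; exact: ler_norm.
Qed.

End WellDefined.

Definition n_star (R : realType) (X : run R) : nat := ex_minn (n_star_subproof X).

(* C_Psi / rho tends to infinity along the runs with rate phi; the dimension,
   hyperparameters, regime, lstar and neighborhood all vary, so that constants
   implied by =O_ may depend on phi only. *)
Definition small_margin (R : realType) (phi : nat -> R) : set_system (run R) :=
  filter_from [set: R] (fun M => [set X : run R |
    (forall n, (0 < n)%N -> rate (alg X) n = phi n) /\ M < C_over_rho X]).

Global Instance small_margin_filter (R : realType) (phi : nat -> R) :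
  Filter (small_margin phi).
Proof.
apply: filter_fromT_filter; first by exists 0.
move=> a b; exists (Num.max a b) => X /= [h].
by rewrite gt_max => /andP[? ?].
Qed.

(* Needed to elaborate [f =O_ (small_margin phi) g]. *)
Canonical small_margin_filter_on (R : realType) (phi : nat -> R) :=
  FilterType (small_margin phi) (small_margin_filter phi).

(* Main.v *)
Require Import Defs.
From HB Require Import structures.
From mathcomp Require Import all_boot all_order all_algebra.
From mathcomp Require Import all_classical all_reals all_analysis.
Import Order.TTheory GRing.Theory Num.Theory.
Import numFieldNormedType.Exports.
Local Open Scope classical_set_scope.
Local Open Scope ring_scope.

(** Write [S] for the ratio [C_over_rho X] of the Lipschitz constant to the
    margin.  The threshold that defines the iteration complexity is then
    [phi n * S < 1], and every rate of the corollary satisfies it at each index [n] above an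
    explicit real number [x]; the first index above [x] is at most [x + 1]
    ([n_star_le]).  It remains to choose [x]:
    - for [c / n], take [x = c * S];
    - for [c / sqrt n], take [x = (c * S) ^ 2];
    - for [c * q ^ k], the constant [c] is absorbed once [S] is at least [c],
      since then [c * S <= S ^ 2], and the threshold is passed as soon as
      [2 * ln S < k * ln (1 / q)] ([geometric_threshold]).  For [k = n] this
      gives [x = 2 * ln S / ln (1 / q)].  For [k = 2 ^ n], once
      [ln S >= 2 / ln (1 / q)] it is enough that [(ln S) ^ 2 < 2 ^ n], and
      [x = 2 * ln (ln S) / ln 2].
    The additive [1] is absorbed for large [S].  Nothing but the rate and [S]
    enters these bounds, so they are uniform in the dimension, the regime, the
    solution and its neighborhood. *)

Section ThresholdIndex.
Variable R : realType.
Implicit Types X : run R.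

Lemma C_over_rho_gt0 X : 0 < C_over_rho X.
Proof. by rewrite divr_gt0 ?rho_gt0 ?C_Psi_gt0. Qed.

(** The first index above [x] passes the threshold, and minimality bounds the
    complexity by it; indices start at 1, which [0 <= x] accommodates. *)
Lemma n_star_le X (x : R) : 0 <= x ->
  (forall n, x < n%:R -> rate (alg X) n * C_over_rho X < 1) ->
  (n_star X)%:R <= x + 1.
Proof.
move=> x0 below; have /andP[tx xt] := truncn_itv x0.
apply: (@le_trans _ _ (Num.truncn x).+1%:R); last by rewrite -natr1 lerD2r.
rewrite ler_nat /n_star; case: ex_minnP => n _; apply => /=.
by rewrite -invf_div -[ltRHS]mul1r ltr_pdivlMr ?C_over_rho_gt0 ?below.
Qed.

Lemma bigO_n_star (phi : nat -> R) (g : run R -> R) (K M : R) : 0 < K ->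
  (forall X, (forall n, (0 < n)%N -> rate (alg X) n = phi n) ->
     M < C_over_rho X -> (n_star X)%:R <= K * g X) ->
  (fun X => (n_star X)%:R : R^o) =O_ (small_margin phi) (g : run R -> R^o).
Proof.
move=> K0 bound; apply/eqO_exP; exists K => //; exists M => // X [rateX MX].
rewrite ger0_norm ?ler0n //; apply: le_trans (bound X rateX MX) _.
by rewrite ler_pM2l // ler_norm.
Qed.

Lemma harmonic_bigO (c : R) : 0 < c ->
  (fun X => (n_star X)%:R : R^o)
    =O_ (small_margin (fun n => c / n%:R)) (fun X => C_over_rho X : R^o).
Proof.
move=> c0; apply: (@bigO_n_star _ _ (c + 1) 1); first by rewrite addr_gt0.
move=> X rateX S1; have S0 := C_over_rho_gt0 X.
apply: (@le_trans _ _ (c * C_over_rho X + 1)).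
  apply: n_star_le => [|n xn]; first by rewrite mulr_ge0 // ltW.
  have n0 : 0 < n%:R :> R by apply: lt_trans xn; rewrite mulr_gt0.
  rewrite rateX; last by rewrite -(ltr0n R).
  by rewrite mulrAC ltr_pdivrMr // mul1r.
by rewrite mulrDl mul1r lerD2l ltW.
Qed.

Lemma inv_sqrt_bigO (c : R) : 0 < c ->
  (fun X => (n_star X)%:R : R^o)
    =O_ (small_margin (fun n => c / Num.sqrt n%:R))
      (fun X => C_over_rho X ^+ 2 : R^o).
Proof.
move=> c0; apply: (@bigO_n_star _ _ (c ^+ 2 + 1) 1).
  by rewrite addr_gt0 ?exprn_gt0.
move=> X rateX S1; have S0 := C_over_rho_gt0 X.
apply: (@le_trans _ _ ((c * C_over_rho X) ^+ 2 + 1)).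
  apply: n_star_le => [|n xn]; first exact: sqr_ge0.
  have n0 : 0 < n%:R :> R by apply: le_lt_trans xn; exact: sqr_ge0.
  rewrite rateX; last by rewrite -(ltr0n R).
  rewrite mulrAC ltr_pdivrMr ?sqrtr_gt0 // mul1r.
  by rewrite -(ger0_norm (ltW (mulr_gt0 c0 S0))) -sqrtr_sqr ltr_sqrt.
by rewrite mulrDl mul1r exprMn lerD2l expr_ge1 // ltW.
Qed.

(** Taking [c <= S] replaces [c * S] by [S ^ 2], whence the factor [2]; the
    constant [c] then disappears from the bound, which is what makes the
    constant for linear convergence independent of both [c] and [q]. *)
Lemma geometric_threshold (c q S : R) (k : nat) :
  0 < c -> 0 < q -> 0 < S -> c <= S -> 2 * ln S < k%:R * ln q^-1 ->
  c * q ^+ k * S < 1.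
Proof.
move=> c0 q0 S0 cS; rewrite !mulr_natl -!lnXn ?invr_gt0 //.
rewrite ltr_ln ?posrE ?exprn_gt0 ?invr_gt0 // exprVn => Sq.
apply: (@le_lt_trans _ _ (S ^+ 2 * q ^+ k)).
  by rewrite mulrAC expr2 ler_pM2r ?exprn_gt0 // ler_pM2r.
by rewrite -ltr_pdivlMr ?exprn_gt0 // mul1r.
Qed.

Lemma ln_inv_gt0 {q : R} : 0 < q < 1 -> 0 < ln q^-1.
Proof. by case/andP=> q0 q1; rewrite ln_gt0 // invf_gt1. Qed.

Lemma linear_rate_bound (c q : R) : 0 < c -> 0 < q < 1 ->
  \forall X \near small_margin (fun n => c * q ^+ n),
    (n_star X)%:R <= 3 * (ln (C_over_rho X) / ln q^-1).
Proof.
move=> c0 q01; have L0 := ln_inv_gt0 q01; have /andP[q0 q1] := q01.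
exists (Num.max c q^-1) => // X [rateX]; rewrite gt_max => /andP[cS qS].
have S0 := C_over_rho_gt0 X; set S := C_over_rho X in cS qS S0 *.
(* [1 / q < S] lets the main term absorb the rounding of the index. *)
have one_le : 1 <= ln S / ln q^-1.
  by rewrite ler_pdivlMr // mul1r ler_ln ?posrE ?invr_gt0 // ltW.
apply: (@le_trans _ _ (2 * (ln S / ln q^-1) + 1)).
  have x0 : 0 < 2 * (ln S / ln q^-1) by rewrite mulr_gt0 // (lt_le_trans ltr01).
  apply: n_star_le => [|n xn]; first exact: ltW.
  rewrite rateX; last by rewrite -(ltr0n R) (lt_trans x0).
  apply: geometric_threshold => //; first exact: ltW.
  by rewrite -ltr_pdivrMr // -mulrA.
by rewrite (natrD _ 2 1) (mulrDl 2) mul1r lerD2l.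
Qed.

(** The coefficient [ln (1 / q)] of [2 ^ n] is traded against one factor [ln S],
    at the price of a factor 2 once the logarithm base 2 is taken. *)
Lemma quadratic_rate_bigO (c q : R) : 0 < c -> 0 < q < 1 ->
  (fun X => (n_star X)%:R : R^o)
    =O_ (small_margin (fun n => c * q ^+ (2 ^ n)%N))
      (fun X => ln (ln (C_over_rho X)) : R^o).
Proof.
move=> c0 q01; have L0 := ln_inv_gt0 q01; have /andP[q0 q1] := q01.
have ln2 : 0 < ln 2 :> R by rewrite ln_gt0 // ltr1n.
(* The second entry makes [2 * ln S <= ln (1 / q) * (ln S) ^ 2]; the third gives
   [1 <= ln (ln S)], which absorbs the rounding of the index. *)
pose M := Num.max c (Num.max (expR (2 / ln q^-1)) (expR (expR 1))).
apply: (@bigO_n_star _ _ (2 / ln 2 + 1) M); first by rewrite addr_gt0 ?divr_gt0.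
move=> X rateX; rewrite !gt_max => /and3P[cS LS eS].
have S0 := C_over_rho_gt0 X; set S := C_over_rho X in cS LS eS S0 *.
have lnS_gt a : expR a < S -> a < ln S.
  by move=> aS; rewrite -[a]expRK ltr_ln ?posrE ?expR_gt0.
have {}LS := lnS_gt _ LS; have {}eS := lnS_gt _ eS.
have lnS0 : 0 < ln S := lt_trans (expR_gt0 1) eS.
have one_le : 1 <= ln (ln S).
  by rewrite -[leLHS]expRK ler_ln ?posrE ?expR_gt0 // ltW.
apply: (@le_trans _ _ (2 / ln 2 * ln (ln S) + 1)).
  have x0 : 0 < 2 / ln 2 * ln (ln S).
    by rewrite mulr_gt0 ?divr_gt0 // (lt_le_trans ltr01).
  apply: n_star_le => [|n xn]; first exact: ltW.
  rewrite rateX; last by rewrite -(ltr0n R) (lt_trans x0).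
  have sq_lt : ln S ^+ 2 < 2 ^+ n.
    rewrite -ltr_ln ?posrE ?exprn_gt0 // !lnXn //.
    rewrite -[ltLHS]mulr_natl -[ltRHS]mulr_natl.
    by rewrite -ltr_pdivrMr // mulrAC.
  apply: geometric_threshold => //; first exact: ltW.
  rewrite natrX -ltr_pdivrMr // mulrAC; apply: lt_trans sq_lt.
  by rewrite expr2 ltr_pM2r.
by rewrite (mulrDl (2 / ln 2)) mul1r lerD2l.
Qed.

End ThresholdIndex.

Theorem corollary13 (R : realType) (c : R) (hc : 0 < c) :
  (* (a) the implied constant does not depend on q *)
  (exists2 K : R, 0 < K & forall q : R, 0 < q < 1 ->
     \forall X \near small_margin (fun n => c * q ^+ n),
       (n_star X)%:R <= K * (ln (C_over_rho X) / ln q^-1)) /\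
  (* (b) *)
  (fun X : run R => (n_star X)%:R : R^o)
    =O_ (small_margin (fun n => c / n%:R)) (fun X => C_over_rho X : R^o) /\
  (* (c) *)
  (fun X : run R => (n_star X)%:R : R^o)
    =O_ (small_margin (fun n => c / Num.sqrt n%:R)) (fun X => C_over_rho X ^+ 2 : R^o) /\
  (* (d) *)
  (fun X : run R => (n_star X)%:R : R^o)
    =O_ (small_margin (fun n => c / n%:R)) (fun X => C_over_rho X : R^o) /\
  (* (e) *)
  (forall q : R, 0 < q < 1 ->
    (fun X : run R => (n_star X)%:R : R^o)
      =O_ (small_margin (fun n => c * q ^+ (2 ^ n)%N))
        (fun X => ln (ln (C_over_rho X)) : R^o)).
Proof.
split; first by exists 3 => // q q01; exact: linear_rate_bound.
split; first exact: harmonic_bigO.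
split; first exact: inv_sqrt_bigO.
split; first exact: harmonic_bigO.
by move=> q q01; exact: quadratic_rate_bigO.
Qed.
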